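(* There exists an absolute constant $c_0>0$ (independent of $N$, $\varepsilon$, $G$ and $\lambda$ below) such that the following holds; in particular one may take $c_0=4\pi$. Let $N\ge 2$ and let $\mathcal{L}(u)=\prod_{j=1}^N (u-z_j)$ be a monic complex polynomial of degree $N$ all of whose zeros $z_1,\dots,z_N$ (listed with multiplicity) lie on the unit circle. Let $\lambda_1,\dots,\lambda_N>0$ with $\sum_{j=1}^N\lambda_j=1$, and let $$\mathcal{L}_\lambda(u)=\sum_{j=1}^N \lambda_j\,\frac{\mathcal{L}(u)}{u-z_j},$$ with zeros $w_1,\dots,w_{N-1}$ counted with multiplicity. Let $\zeta_1=e^{i\theta_1},\dots,\zeta_M=e^{i\theta_M}$ be the distinct zeros of $\mathcal{L}$, with $0\le\theta_1<\theta_2<\cdots<\theta_M<2\pi$, put $\theta_{M+1}:=\theta_1+2\pi$, and let $$G=\max_{1\le j\le M}(\theta_{j+1}-\theta_j).$$ For $\varepsilon\in(0,1)$ let $\mathcal{N}_\varepsilon$ be the number of indices $k\in\{1,\dots,N-1\}$ with $|w_k|<1-\varepsilon$ (that is, the number of zeros of $\mathcal{L}_\lambda$, counted with multiplicity, at distance greater than $\varepsilon$ from the unit circle). Then $$\mathcal{N}_\varepsilon\le\frac{c_0}{\varepsilon\,G}.$$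
   Context: Each $\mathcal{L}(u)/(u-z_j)$ is a monic polynomial of degree $N-1$, so $\mathcal{L}_\lambda$ is a monic polynomial of degree $N-1$; it is known that all of its zeros lie in the closed unit disk. *)

(* Defs.v *)
From HB Require Import structures.
From mathcomp Require Export all_boot all_order all_algebra.
From mathcomp Require Export complex.
From mathcomp Require Export reals trigo.

Set Implicit Arguments.
Unset Strict Implicit.
Unset Printing Implicit Defensive.

Import Order.TTheory GRing.Theory Num.Theory.

Local Open Scope ring_scope.
Local Open Scope complex_scope.

Definition expi (R : realType) (t : R) : R[i] := cos t +i* sin t.

Definition monic_with_zeros (R : realType) (n : nat) (z : 'I_n -> R[i]) :
    {poly R[i]} :=
  \prod_(j < n) ('X - (z j)%:P).

Definition convex_deriv (R : realType) (N : nat) (lambda : 'I_N -> R)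
    (z : 'I_N -> R[i]) : {poly R[i]} :=
  \sum_(j < N)
    (lambda j)%:C *: (monic_with_zeros z %/ ('X - (z j)%:P)).

(* The zeros are expi (theta 1), ..., expi (theta M); theta M.+1 stores the
   wrapped-around angle theta 1 + 2 pi, and theta is irrelevant elsewhere. *)
Definition zero_angles (R : realType) (p : {poly R[i]}) (M : nat)
    (theta : nat -> R) : Prop :=
  [/\ forall j, (1 <= j <= M)%N -> 0 <= theta j < 2 * pi,
      forall j, (1 <= j < M)%N -> theta j < theta j.+1,
      theta M.+1 = theta 1%N + 2 * pi
    & forall u : R[i],
        root p u <-> exists2 j : nat, (1 <= j <= M)%N & u = expi (theta j)].

(* The base value 0 does not affect the maximum: under zero_angles all gaps
   are positive. *)
Definition max_gap (R : realType) (M : nat) (theta : nat -> R) : R :=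
  \big[Num.max/0]_(1 <= j < M.+1) (theta j.+1 - theta j).

Definition num_inner (R : realType) (n : nat) (w : 'I_n -> R[i]) (eps : R) :
    nat :=
  #|[pred k : 'I_n | `|w k| < (1 - eps)%:C]|.

(* Main.v *)
Require Import Defs.
From mathcomp Require Import ring lra.
From mathcomp Require Import boolp functions topology.
From mathcomp Require Import normedtype derive realfun.

(** Write L for the polynomial with zeros [z j] on the unit circle, and put
    [A(u) = sum_j lambda_j u / (u - z_j)], so that the weighted derivative of L
    at [u] is [L(u) A(u) / u].  On the unit circle each kernel [u / (u - z_j)]
    has real part 1/2, hence [A(e^(it)) = (1 + i h(t)) / 2] for a real function
    [h] ([phase_cot]), which is smooth away from the angles of the [z_j].
    Off the closed disk the real part of [A] exceeds 1/2, so all the zeros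
    [w_k] lie in the closed disk ([normsq_zero_le1], in the style of
    Gauss and Lucas).

    Computing the logarithmic derivative of the weighted derivative in two
    ways, once from its zeros [w_k] and once from its expression with the
    [z_j], and taking real parts, gives ([phase_cot_derivE])
      [h' / (1 + h^2) = (1 + sum_k P(e^(it), w_k)) / 2],
    where [P] is the Poisson kernel.  In other words [2 atan h] is, up to a
    constant, the argument on the circle of the Blaschke product with zeros 0
    and the [w_k] of modulus less than 1, normalized so that it takes the value
    1 exactly at the [z_j].

    Each [w_k] with [|w_k| < 1 - eps] contributes at least [eps / 2] to the sum
    of Poisson kernels and the others contribute nonnegatively.  Between two
    consecutive zeros of L, [h] is smooth and [atan h] increases by at most
    [pi]; by the mean value theorem a gap of length [g] therefore satisfies
    [g (1 + n eps / 2) / 2 <= pi] ([zero_free_open_arc_le]), with [n] the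
    number of such [w_k].  Hence [n eps g <= 4 pi]. *)

Set Implicit Arguments.
Unset Strict Implicit.
Unset Printing Implicit Defensive.

Import Order.TTheory GRing.Theory Num.Theory.
Import numFieldNormedType.Exports.
Local Open Scope ring_scope.
Local Open Scope complex_scope.

(** * Polynomials with given linear factors *)

Section Algebra.
Variable (F : fieldType).

Lemma horner_prod_XsubC_neq0 (I : Type) (r : seq I) (w : I -> F) u :
  (forall i, u != w i) -> (\prod_(i <- r) ('X - (w i)%:P)).[u] != 0.
Proof.
move=> uw; elim/big_rec: _ => [|i p _ p0]; first by rewrite hornerC oner_neq0.
by rewrite hornerM mulf_neq0// hornerXsubC subr_eq0.
Qed.

Lemma horner_deriv_prod_XsubC (I : Type) (r : seq I) (w : I -> F) u :
  (forall i, u != w i) ->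
  (\prod_(i <- r) ('X - (w i)%:P))^`().[u] =
  (\prod_(i <- r) ('X - (w i)%:P)).[u] * \sum_(i <- r) (u - w i)^-1.
Proof.
move=> uw; elim: r => [|i r IH]; first by rewrite !big_nil derivC horner0 mulr0.
rewrite !big_cons derivM derivXsubC mul1r hornerD !hornerM IH hornerXsubC.
have : u - w i != 0 by rewrite subr_eq0.
by move=> ?; field.
Qed.

Lemma horner_divp_XsubC (p : {poly F}) (z u : F) :
  root p z -> u != z -> (p %/ ('X - z%:P)).[u] = p.[u] / (u - z).
Proof.
move=> pz uz; have uz0 : u - z != 0 by rewrite subr_eq0.
rewrite -[p in RHS](@divpK _ ('X - z%:P)) ?dvdp_XsubCl//.
by rewrite hornerM hornerXsubC mulfK.
Qed.

Lemma horner_deriv_divp_XsubC (p : {poly F}) (z u : F) :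
  root p z -> u != z ->
  (p %/ ('X - z%:P))^`().[u] = p^`().[u] / (u - z) - p.[u] / (u - z) ^+ 2.
Proof.
move=> pz uz; have uz0 : u - z != 0 by rewrite subr_eq0.
have -> : p^`() = (p %/ ('X - z%:P))^`() * ('X - z%:P) + p %/ ('X - z%:P).
  by rewrite -{1}(@divpK _ ('X - z%:P) p) ?dvdp_XsubCl// derivM derivXsubC mulr1.
rewrite hornerD hornerM hornerXsubC horner_divp_XsubC//.
by field.
Qed.
End Algebra.

(** * Kernels on the unit circle *)

Section Circle.
Variable R : realType.
Implicit Types (u w z : R[i]) (t : R).

(** The squared modulus, as a real number: the norm of [R[i]] itself takes its
    values in [R[i]]. *)
Definition normsq z : R := complex.Re z ^+ 2 + complex.Im z ^+ 2.

Lemma normsqE z : (normsq z)%:C = z * z^*.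
Proof. by rewrite /normsq add_Re2_Im2 sqr_normc. Qed.

Lemma normsq_eq0 z : (normsq z == 0) = (z == 0).
Proof. by rewrite -(inj_eq (@complexI R)) normsqE mulf_eq0 conjc_eq0 orbb. Qed.

Lemma normsq_ge0 z : 0 <= normsq z.
Proof. by rewrite addr_ge0 ?sqr_ge0. Qed.

Lemma normsq_norm z (r : R) : `|z| = r%:C -> normsq z = r ^+ 2.
Proof. by move=> zr; apply: complexI; rewrite normsqE -sqr_normc zr rmorphXn. Qed.

Lemma normsq_expi t : normsq (expi t) = 1.
Proof. by rewrite /normsq /= cos2Dsin2. Qed.

(** The Poisson kernel of the unit disk, for [u] on the unit circle. *)
Definition poisson u w : R := (1 - normsq w) / normsq (u - w).

(** For [|u| = 1] the right-hand side is [(1 + poisson u w) / 2]. *)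
Lemma Re_divB u w : u != w ->
  complex.Re (u / (u - w)) = (1 + (normsq u - normsq w) / normsq (u - w)) / 2.
Proof.
rewrite -subr_eq0 -normsq_eq0; case: u w => [a b] [c d].
by rewrite /normsq /= => D0; field; rewrite D0.
Qed.

Lemma poisson_ge0 (u w : R[i]) : normsq w <= 1 -> 0 <= poisson u w.
Proof. by move=> w1; rewrite divr_ge0 ?normsq_ge0// subr_ge0. Qed.

Lemma poisson_ge (u w : R[i]) (eps : R) : normsq u = 1 ->
  0 < eps -> `|w| < (1 - eps)%:C -> eps / 2 <= poisson u w.
Proof.
move=> u1 e0 we.
pose r := complex.Re `|w|.
have wr : `|w| = r%:C by rewrite /r normc_def.
have r0 : 0 <= r by rewrite -ler0c -wr.
move: we; rewrite wr ltcR => re.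
have nw : normsq w = r ^+ 2 by exact: normsq_norm.
have nu : `|u| = 1.
  by apply/eqP; rewrite -sqrp_eq1// -add_Re2_Im2 -/(normsq u) u1.
have D1 : normsq (u - w) <= (1 + r) ^+ 2.
  rewrite -lecR add_Re2_Im2 rmorphXn rmorphD rmorph1 [X in 1 + X](_ : _ = `|w|)//.
  by rewrite lerXn2r ?nnegrE ?addr_ge0// -nu ler_normB.
have D0 : 0 < normsq (u - w).
  rewrite lt0r normsq_ge0 normsq_eq0 subr_eq0 andbT.
  apply/eqP => uw; have : `|w| < 1 by rewrite wr (ltcR r 1); lra.
  by rewrite -uw nu ltxx.
rewrite /poisson nw ler_pdivlMr//.
(* (1 - r^2) / (1 + r)^2 = (1 - r) / (1 + r) with 1 - r > eps and r < 1 *)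
apply: (@le_trans _ _ (eps / 2 * (1 + r) ^+ 2)).
  by rewrite ler_pM2l// divr_gt0.
rewrite -subr_ge0.
have -> : 1 - r ^+ 2 - eps / 2 * (1 + r) ^+ 2 =
    (1 + r) * ((1 - eps - r) + eps * (1 - r) / 2) by field.
apply: mulr_ge0; first lra.
have : 0 <= eps * (1 - r) by apply: mulr_ge0; lra.
lra.
Qed.

Lemma Re_sum (I : Type) (r : seq I) (f : I -> R[i]) :
  complex.Re (\sum_(i <- r) f i) = \sum_(i <- r) complex.Re (f i).
Proof. by apply: (big_morph (@complex.Re R)) => // -[a b] []. Qed.

Lemma Im_sum (I : Type) (r : seq I) (f : I -> R[i]) :
  complex.Im (\sum_(i <- r) f i) = \sum_(i <- r) complex.Im (f i).
Proof. by apply: (big_morph (@complex.Im R)) => // -[a b] []. Qed.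

(** Half the squared distance from [expi t] to a point [z] of the circle,
    written as a trigonometric polynomial in [t]. *)
Definition half_dist2 z t : R :=
  1 - (complex.Re z * cos t + complex.Im z * sin t).

(** For [z = expi a] this is [- cot ((t - a) / 2)]; the form chosen requires no
    choice of an argument [a] of [z]. *)
Definition half_cot z t : R :=
  (complex.Im z * cos t - complex.Re z * sin t) / half_dist2 z t.

Lemma half_dist2E z t : normsq z = 1 ->
  half_dist2 z t = normsq (expi t - z) / 2.
Proof.
case: z => a b; rewrite /normsq /half_dist2 /= => z1.
have := cos2Dsin2 t => c1; lra.
Qed.

Lemma half_dist2_gt0 z t : normsq z = 1 -> expi t != z -> 0 < half_dist2 z t.
Proof.
move=> z1 uz; rewrite half_dist2E// divr_gt0// lt_neqAle normsq_ge0 andbT.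
by rewrite eq_sym normsq_eq0 subr_eq0.
Qed.

Lemma cauchy_kernel_expi z t : normsq z = 1 -> expi t != z ->
  expi t / (expi t - z) = 2^-1 +i* (half_cot z t / 2).
Proof.
move=> z1 uz; have D0 := half_dist2_gt0 z1 uz.
have N0 : expi t - z != 0 by rewrite subr_eq0.
apply: (mulIf N0); rewrite divfK//; apply/eqP; rewrite eq_complex /half_cot.
move: D0; rewrite lt0r => /andP[D0 _].
case: z z1 {uz N0} D0 => a b; rewrite /half_dist2 /normsq /= => z1 D0.
have b2 : b ^+ 2 = 1 - a ^+ 2 by rewrite -z1 addrAC subrr add0r.
have s2 := sin2cos2 t.
apply/andP; split; apply/eqP; field: b2 s2; exact: D0.
Qed.

(** The left-hand side is [u z / (u - z) ^ 2] for [u = expi t]. *)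
Lemma cauchy_kernel2_expi z t : normsq z = 1 -> expi t != z ->
  (expi t / (expi t - z)) ^+ 2 - expi t / (expi t - z) =
  - ((half_dist2 z t)^-1 / 2)%:C.
Proof.
move=> z1 uz; have D0 := half_dist2_gt0 z1 uz.
rewrite cauchy_kernel_expi//; apply/eqP; rewrite eq_complex /half_cot.
move: D0; rewrite lt0r => /andP[D0 _].
case: z z1 {uz} D0 => a b; rewrite /half_dist2 /normsq /= => z1 D0.
have b2 : b ^+ 2 = 1 - a ^+ 2 by rewrite -z1 addrAC subrr add0r.
have s2 := sin2cos2 t.
apply/andP; split; apply/eqP; field: b2 s2; exact: D0.
Qed.

Lemma is_derive_half_cot (z : R[i]) (t : R) : normsq z = 1 -> expi t != z ->
  is_derive t 1 (half_cot z) (half_dist2 z t)^-1.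
Proof.
move=> z1 uz; have D0 := half_dist2_gt0 z1 uz.
have D0' : half_dist2 z t != 0 by rewrite gt_eqF.
pose n s := complex.Im z * cos s - complex.Re z * sin s.
have dN : is_derive t 1 n (half_dist2 z t - 1).
  by apply: is_derive_eq; rewrite /half_dist2 /GRing.scale /=; ring.
have dD : is_derive t 1 (half_dist2 z) (- n t).
  by apply: is_derive_eq; rewrite /n /GRing.scale /=; ring.
have dV := is_deriveV D0' dD.
have -> : half_cot z = (fun s => n s * (half_dist2 z s)^-1) by [].
apply: is_derive_eq; rewrite /GRing.scale /=.
have nD : n t ^+ 2 = 2 * half_dist2 z t - half_dist2 z t ^+ 2.
  have s2 := sin2cos2 t; rewrite /n /half_dist2.
  case: z z1 {uz D0 D0' n dN dD dV} => a b; rewrite /normsq /= => z1.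
  have b2 : b ^+ 2 = 1 - a ^+ 2 by rewrite -z1 addrAC subrr add0r.
  by ring: b2 s2.
by field: nD.
Qed.
End Circle.

(** * The weighted derivative on the unit circle *)

Section Phase.
Variables (R : realType) (N : nat) (z : 'I_N -> R[i]) (lambda : 'I_N -> R).
Hypothesis z_circle : forall j, normsq (z j) = 1.
Hypothesis lambda_gt0 : forall j, 0 < lambda j.
Hypothesis sum_lambda : \sum_(j < N) lambda j = 1.

(** The ratio of [convex_deriv lambda z] to [monic_with_zeros z], away from the
    points [z j]. *)
Definition cauchy_sum (u : R[i]) : R[i] :=
  \sum_(j < N) (lambda j)%:C / (u - z j).

Lemma root_monic_with_zeros j : root (monic_with_zeros z) (z j).
Proof.
apply/rootP; rewrite /monic_with_zeros (bigD1 j)//= hornerM hornerXsubC subrr.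
by rewrite mul0r.
Qed.

Lemma horner_convex_deriv u : (forall j, u != z j) ->
  (convex_deriv lambda z).[u] = (monic_with_zeros z).[u] * cauchy_sum u.
Proof.
move=> uz; rewrite /convex_deriv horner_sum mulr_sumr; apply: eq_bigr => j _.
rewrite hornerZ horner_divp_XsubC ?root_monic_with_zeros//; exact: mulrCA.
Qed.

Lemma horner_deriv_convex_deriv u : (forall j, u != z j) ->
  (convex_deriv lambda z)^`().[u] = (monic_with_zeros z)^`().[u] * cauchy_sum u
  - (monic_with_zeros z).[u] * \sum_(j < N) (lambda j)%:C / (u - z j) ^+ 2.
Proof.
move=> uz; rewrite /convex_deriv raddf_sum /= horner_sum !mulr_sumr -sumrB.
apply: eq_bigr => j _.
rewrite derivZ hornerZ horner_deriv_divp_XsubC ?root_monic_with_zeros//.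
by rewrite mulrBr; congr (_ - _); exact: mulrCA.
Qed.

Lemma Re_mul_cauchy_sum_ge u : 1 <= normsq u -> (forall j, u != z j) ->
  2^-1 <= complex.Re (u * cauchy_sum u).
Proof.
move=> u1 uz; rewrite mulr_sumr Re_sum.
have -> : 2^-1 = \sum_(j < N) lambda j / 2.
  by rewrite -mulr_suml sum_lambda mul1r.
apply: ler_sum => j _; rewrite mulrCA.
have -> (a : R) (x : R[i]) : complex.Re (a%:C * x) = a * complex.Re x.
  by case: x => b c /=; rewrite mul0r subr0.
rewrite ler_pM2l// Re_divB// z_circle -[leLHS]mul1r ler_pM2r ?invr_gt0//.
by rewrite lerDl divr_ge0 ?normsq_ge0// subr_ge0.
Qed.

Variable w : 'I_N.-1 -> R[i].
Hypothesis w_zeros : convex_deriv lambda z = monic_with_zeros w.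

(** Gauss-Lucas for the weighted derivative. *)
Lemma normsq_zero_le1 k : normsq (w k) <= 1.
Proof.
rewrite leNgt; apply/negP => w1.
have wz j : w k != z j.
  by apply: contraTneq w1 => ->; rewrite z_circle ltxx.
have : (convex_deriv lambda z).[w k] = 0.
  rewrite w_zeros /monic_with_zeros (bigD1 k)//= hornerM hornerXsubC subrr.
  by rewrite mul0r.
rewrite horner_convex_deriv// => /eqP; rewrite mulf_eq0.
rewrite (negbTE (horner_prod_XsubC_neq0 _ wz))/= => /eqP S0.
have := Re_mul_cauchy_sum_ge (ltW w1) wz.
by rewrite S0 mulr0 /=; lra.
Qed.

(** The imaginary part of [2 u * cauchy_sum u] at [u = expi t], away from the
    [z j]. *)
Definition phase_cot (t : R) : R := \sum_(j < N) lambda j * half_cot (z j) t.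

Lemma cauchy_sum_expi t : (forall j, expi t != z j) ->
  expi t * cauchy_sum (expi t) = 2^-1 +i* (phase_cot t / 2).
Proof.
move=> uz; rewrite mulr_sumr.
under eq_bigr => j _ do rewrite mulrCA cauchy_kernel_expi//.
apply/eqP; rewrite eq_complex Re_sum Im_sum /=.
apply/andP; split; apply/eqP.
  under eq_bigr => j _ do rewrite mul0r subr0.
  by rewrite -mulr_suml sum_lambda mul1r.
by rewrite mulr_suml; apply: eq_bigr => j _; rewrite mul0r addr0 mulrA.
Qed.

(** The left-hand side is the derivative of [phase_cot] at [t], see
    [is_derive_phase_cot]. *)
Lemma phase_cot_derivE t : (forall j, expi t != z j) ->
  \sum_(j < N) lambda j / half_dist2 (z j) t =
  (1 + phase_cot t ^+ 2) / 2 * (1 + \sum_(k < N.-1) poisson (expi t) (w k)).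
Proof.
move=> uz; set u := expi t.
have u1 : normsq u = 1 by exact: normsq_expi.
have N0 : (0 < N)%N.
  case: (N) lambda sum_lambda => // l.
  by rewrite big_ord0 => /eqP; rewrite eq_sym oner_eq0.
have L0 : (monic_with_zeros z).[u] != 0 by exact: horner_prod_XsubC_neq0.
have S0 : cauchy_sum u != 0.
  apply/eqP => S0; have := Re_mul_cauchy_sum_ge (_ : 1 <= normsq u) uz.
  by rewrite u1 -/u S0 mulr0 => /(_ (lexx _)) /=; lra.
have uw k : u != w k.
  apply: contra_neq (mulf_neq0 L0 S0) => uwk.
  rewrite -horner_convex_deriv// w_zeros /monic_with_zeros (bigD1 k)//=.
  by rewrite hornerM hornerXsubC uwk subrr mul0r.
set h := phase_cot t; set dh := LHS.
have ReX (n : nat) (x : 'I_n -> R[i]) : (forall i, u != x i) ->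
    complex.Re (u * \sum_(i < n) (u - x i)^-1) =
    (n%:R + \sum_(i < n) poisson u (x i)) / 2.
  move=> ux; rewrite mulr_sumr Re_sum.
  under eq_bigr => i _ do rewrite Re_divB// u1.
  by rewrite -mulr_suml big_split /= sumr_const card_ord.
have poissonz : \sum_(j < N) poisson u (z j) = 0.
  by rewrite big1// => j _; rewrite /poisson z_circle subrr mul0r.
pose X := 1 + u * \sum_(k < N.-1) (u - w k)^-1
            - u * \sum_(j < N) (u - z j)^-1.
have ReXE : complex.Re X = (1 + \sum_(k < N.-1) poisson u (w k)) / 2.
  have ReB (x y : R[i]) : complex.Re (1 + x - y)
      = 1 + complex.Re x - complex.Re y by case: x y => [? ?] [? ?].
  rewrite ReB !ReX// poissonz.
  have -> : N%:R = N.-1%:R + 1 :> R by rewrite natr1 prednK.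
  by field.
(* Both expressions of the derivative of convex_deriv lambda z at u agree:
   with S = cauchy_sum u, T and U below, and S2 = - S'(u), this reads
   L S T = L U S - L S2. *)
have key : (2^-1 +i* (h / 2)) * X = (dh / 2)%:C.
  rewrite -cauchy_sum_expi// -/u.
  have := horner_deriv_convex_deriv uz.
  rewrite w_zeros !horner_deriv_prod_XsubC// -/(monic_with_zeros w).
  rewrite -w_zeros horner_convex_deriv// -/u.
  set S2 := \sum_(j < N) _ / _ ^+ 2.
  set T := \sum_(k < N.-1) _; set U := \sum_(j < N) _.
  have S2E : u ^+ 2 * S2 = u * cauchy_sum u - (dh / 2)%:C.
    rewrite [u * cauchy_sum u]mulr_sumr mulr_suml rmorph_sum mulr_sumr -sumrB.
    apply: eq_bigr => j _; rewrite -mulrA rmorphM /=.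
    have -> : ((half_dist2 (z j) t)^-1 / 2)%:C =
        - ((u / (u - z j)) ^+ 2 - u / (u - z j)).
      by rewrite cauchy_kernel2_expi// opprK.
    have : u - z j != 0 by rewrite subr_eq0.
    by move=> ?; field.
  rewrite -!mulrA -mulrBr => /(mulfI L0) E.
  have -> : (dh / 2)%:C = u * cauchy_sum u - u ^+ 2 * S2 by rewrite S2E; ring.
  rewrite /X -/T -/U; ring: E.
move/eqP: key; rewrite eq_complex; move: ReXE.
case: X => a b /= aE /andP[/eqP E1 /eqP E2].
(* key says (1 + i h) (a + i b) = dh, whose imaginary part vanishes. *)
have bE : b = - (h * a) by lra.
have -> : 1 + \sum_(k < N.-1) poisson u (w k) = 2 * a by rewrite aE; field.
by move: E1; rewrite bE -/h => E1; lra.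
Qed.
End Phase.

(** * Arcs free of zeros *)

Section Gap.
Variables (R : realType) (N : nat) (z : 'I_N -> R[i]) (lambda : 'I_N -> R).
Hypothesis z_circle : forall j, normsq (z j) = 1.
Hypothesis lambda_gt0 : forall j, 0 < lambda j.
Hypothesis sum_lambda : \sum_(j < N) lambda j = 1.

Lemma is_derive_phase_cot (t : R) : (forall j, expi t != z j) ->
  is_derive t 1 (phase_cot z lambda)
    (\sum_(j < N) lambda j / half_dist2 (z j) t).
Proof.
move=> uz.
pose f (j : 'I_N) (s : R) := lambda j * half_cot (z j) s.
have -> : phase_cot z lambda = \sum_(j < N) f j.
  by apply/funext => s; rewrite fct_sumE.
apply: is_derive_sum => j.
have := is_derive_half_cot (z_circle j) (uz j) => d.
exact: (@is_deriveZ _ _ _ (half_cot (z j)) (lambda j)).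
Qed.

Variable w : 'I_N.-1 -> R[i].
Hypothesis w_zeros : convex_deriv lambda z = monic_with_zeros w.

Lemma sum_poisson_ge (u : R[i]) (eps : R) : normsq u = 1 -> 0 < eps ->
  (num_inner w eps)%:R * (eps / 2) <= \sum_(k < N.-1) poisson u (w k).
Proof.
move=> u1 e0.
rewrite (bigID (fun k => `|w k| < (1 - eps)%:C))/=.
rewrite -[leLHS]addr0 lerD//; last first.
  apply: sumr_ge0 => k _; apply: poisson_ge0.
  exact: (normsq_zero_le1 z_circle lambda_gt0 sum_lambda w_zeros).
rewrite mulrC mulr_natr -sumr_const; apply: ler_sum => k; exact: poisson_ge.
Qed.

(** The variation of [atan \o phase_cot] over the arc is less than [pi], while
    its derivative is at least the second factor. *)
Lemma zero_free_arc_le (eps a b : R) : 0 < eps -> a < b ->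
  (forall t, a <= t <= b -> forall j, expi t != z j) ->
  (b - a) * ((1 + (num_inner w eps)%:R * (eps / 2)) / 2) <= pi.
Proof.
move=> e0 ab free.
pose df t := (1 + phase_cot z lambda t ^+ 2)^-1 *
  \sum_(j < N) lambda j / half_dist2 (z j) t.
have dF t : a <= t <= b -> is_derive t 1 (atan \o phase_cot z lambda) (df t).
  move=> tab; have := is_derive_phase_cot (free t tab) => d.
  exact: is_derive1_comp.
have [||c] := @MVT R (atan \o phase_cot z lambda) df a b ab.
- by move=> t; rewrite in_itv/= => /andP[at_ tb]; apply: dF; rewrite !ltW.
- by apply: derivable_within_continuous => t; rewrite in_itv/= => /dF[].
rewrite in_itv/= => /andP[/ltW ac /ltW cb] /= E.
have cab : a <= c <= b by rewrite ac.
have dfE : df c = (1 + \sum_(k < N.-1) poisson (expi c) (w k)) / 2.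
  rewrite /df (phase_cot_derivE z_circle lambda_gt0 sum_lambda w_zeros)//.
    have : 1 + phase_cot z lambda c ^+ 2 != 0.
      by rewrite gt_eqF// ltr_pwDl// sqr_ge0.
    by move=> ?; field.
  exact: free.
have lt_pi : df c * (b - a) < pi.
  rewrite -E; have := atan_ltpi2 (phase_cot z lambda b).
  by have := atan_gtNpi2 (phase_cot z lambda a); lra.
apply: le_trans (ltW lt_pi); rewrite mulrC ler_pM2r ?subr_gt0// dfE.
by rewrite ler_pM2r ?invr_gt0// lerD2l sum_poisson_ge// normsq_expi.
Qed.

(** The bound persists when the zeros sit at the ends of the arc, by exhausting
    it with slightly shorter arcs. *)
Lemma zero_free_open_arc_le (eps a b : R) : 0 < eps -> a < b ->
  (forall t, a < t < b -> forall j, expi t != z j) ->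
  (b - a) * ((1 + (num_inner w eps)%:R * (eps / 2)) / 2) <= pi.
Proof.
move=> e0 ab free; set K := _ / 2.
have K0 : 0 < K by rewrite divr_gt0// ltr_pwDl// mulr_ge0// divr_ge0// ltW.
rewrite -ler_pdivlMr//; apply/ler_addgt0Pr => d d0.
pose e := Num.min (d / 2) ((b - a) / 4).
have e0' : 0 < e by rewrite lt_min !divr_gt0// subr_gt0.
have ed : e <= d / 2 by rewrite ge_min lexx.
have eba : e <= (b - a) / 4 by rewrite ge_min lexx orbT.
have := @zero_free_arc_le eps (a + e) (b - e) e0; rewrite -/K.
have -> : a + e < b - e by lra.
move=> /(_ isT); rewrite -ler_pdivlMr// => H.
have {}H : b - e - (a + e) <= pi / K.
  by apply: H => t /andP[t1 t2]; apply: free; lra.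
lra.
Qed.
End Gap.

(** * Gaps between consecutive zeros *)

Section Angles.
Variable R : realType.

Lemma expi_inj (a b : R) : 0 <= a < 2 * pi -> 0 <= b < 2 * pi ->
  expi a = expi b -> a = b.
Proof.
wlog ab : a b / a < b => [H|] ha hb E.
  by case: (ltgtP a b) => // ab; [apply: H | apply/esym/H].
case: E => Ec Es.
have c1 : cos (b - a) = 1 by rewrite cosB Ec Es -!expr2 cos2Dsin2.
have : 0 < sin ((b - a) / 2).
  by apply: sin_gt0_pi; move: ha hb => /andP[? ?] /andP[? ?]; lra.
have /eqP : sin ((b - a) / 2) ^+ 2 = 0.
  have := cosD ((b - a) / 2) ((b - a) / 2).
  rewrite -splitr c1 -!expr2 cos2sin2; lra.
by rewrite sqrf_eq0 => /eqP ->; rewrite ltxx.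
Qed.

Lemma expiB2pi (t : R) : expi (t - 2 * pi) = expi t.
Proof.
have {2}-> : t = t - 2 * pi + pi *+ 2 by rewrite -mulr_natl; ring.
by rewrite /expi sinD2pi cosD2pi.
Qed.

Variables (p : {poly R[i]}) (M : nat) (theta : nat -> R).
Hypothesis angles : zero_angles p M theta.

Lemma theta_lt i j : (1 <= i)%N -> (i < j)%N -> (j <= M)%N -> theta i < theta j.
Proof.
case: angles => _ incr _ _ i1; elim: j => // j IH; rewrite ltnS leq_eqVlt.
move=> /predU1P[<- iM|ij jM]; first by apply: incr; rewrite i1.
apply: lt_trans (IH ij (ltnW jM)) _; apply: incr.
by rewrite jM andbT (leq_trans i1 (ltnW ij)).
Qed.

Lemma gap_gt0 j : (1 <= j <= M)%N -> theta j < theta j.+1.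
Proof.
case: angles => bnd incr wrap _ /andP[j1 jM].
have [jM'|] := ltnP j M; first by apply: incr; rewrite j1.
move=> Mj; have -> : j = M by apply/eqP; rewrite eqn_leq jM.
have M1 : (1 <= M)%N := leq_trans j1 jM.
have /andP[_ h] : 0 <= theta M < 2 * pi by apply: bnd; rewrite M1 /=.
have /andP[h1 _] : 0 <= theta 1%N < 2 * pi by apply: bnd; rewrite M1.
rewrite wrap; lra.
Qed.

Lemma gap_zero_free j t : (1 <= j <= M)%N -> theta j < t < theta j.+1 ->
  ~~ root p (expi t).
Proof.
move=> jM /andP[t1 t2]; apply/negP.
case: (angles) => bnd incr wrap rootE /rootE[i iM E].
have bi := bnd _ iM; have bj := bnd _ jM.
move: (jM) (iM) => /andP[j1 jM'] /andP[i1 iM'].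
(* t >= 2 pi is possible only in the gap that wraps around, where t - 2 pi is
   smaller than theta 1. *)
have [tpi|tpi] := ltP t (2 * pi).
  have ti : t = theta i.
    by apply: expi_inj => //; move: bj => /andP[? ?]; lra.
  have [ij|ij] := leqP i j.
    have : theta i <= theta j.
      by move: ij; rewrite leq_eqVlt => /predU1P[->//|ij]; apply/ltW/theta_lt.
    by rewrite -ti; lra.
  have : theta j.+1 <= theta i.
    move: ij; rewrite leq_eqVlt => /predU1P[->//|ij].
    by apply/ltW/theta_lt.
  by rewrite -ti; lra.
have Mj : (M <= j)%N.
  rewrite leqNgt; apply/negP => jltM.
  have /andP[_ ?] : 0 <= theta j.+1 < 2 * pi by apply: bnd.
  lra.
have jE : j = M by apply/eqP; rewrite eqn_leq jM'.
move: t2; rewrite jE wrap => t2.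
have /andP[h1 h2] : 0 <= theta 1%N < 2 * pi by apply: bnd; exact: leq_trans jM'.
have ti : t - 2 * pi = theta i.
  by apply: expi_inj => //; [lra | rewrite expiB2pi].
have : theta 1%N <= theta i.
  move: i1; rewrite leq_eqVlt => /predU1P[<-//|i1].
  by apply/ltW/theta_lt.
by rewrite -ti; lra.
Qed.

(** A root is needed: [max_gap] is 0 when there are no angles. *)
Lemma max_gap_gt0 : (exists u, root p u) -> 0 < max_gap M theta.
Proof.
case: (angles) => _ _ _ rootE [u /rootE[j /andP[j1 jM] _]].
have : theta j.+1 - theta j <= max_gap M theta.
  rewrite /max_gap; apply: (@le_bigmax_seq _ _ _ _ _ j predT
    (fun i => theta i.+1 - theta i)) => //.
  by rewrite mem_index_iota j1 ltnS.
by apply: lt_le_trans; rewrite subr_gt0 gap_gt0// j1.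
Qed.
End Angles.

(** * The number of inner zeros *)

Theorem theorem1p6 (R : realType) :
  exists c0 : R, [/\ 0 < c0, c0 = 4 * pi &
    forall (N : nat) (z : 'I_N -> R[i]) (lambda : 'I_N -> R)
           (w : 'I_N.-1 -> R[i]) (M : nat) (theta : nat -> R) (eps : R),
      (2 <= N)%N ->
      (forall j, `|z j| = 1) ->
      (forall j, 0 < lambda j) ->
      \sum_(j < N) lambda j = 1 ->
      convex_deriv lambda z = monic_with_zeros w ->
      zero_angles (monic_with_zeros z) M theta ->
      0 < eps < 1 ->
      (num_inner w eps)%:R <= c0 / (eps * max_gap M theta)].
Proof.
exists (4 * pi); split=> //; first by rewrite mulr_gt0// pi_gt0.
move=> N z lambda w M theta eps N2 z1 l0 l1 wz angles /andP[e0 _].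
have zc j : normsq (z j) = 1 by rewrite (@normsq_norm _ _ 1) ?expr1n// z1.
have N0 : (0 < N)%N := ltnW N2.
have G0 : 0 < max_gap M theta.
  apply: (max_gap_gt0 angles); exists (z (Ordinal N0)).
  exact: root_monic_with_zeros.
set n := (num_inner w eps)%:R; pose K : R := (1 + n * (eps / 2)) / 2.
have K0 : 0 < K.
  by rewrite divr_gt0// ltr_pwDl// mulr_ge0// divr_ge0// ltW.
have GK : max_gap M theta <= pi / K.
  rewrite /max_gap big_seq; apply: bigmax_le => [|j].
    by rewrite divr_ge0 ?pi_ge0// ltW.
  rewrite mem_index_iota ltnS => jM; rewrite ler_pdivlMr//.
  apply: (zero_free_open_arc_le zc l0 l1 wz e0 (gap_gt0 angles jM)) => t tj i.
  apply: contraNneq (gap_zero_free angles jM tj) => ->.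
  exact: root_monic_with_zeros.
rewrite ler_pdivlMr ?mulr_gt0//.
have {}GK : max_gap M theta * K <= pi by rewrite -ler_pdivlMr.
have : max_gap M theta * K =
    max_gap M theta / 2 + n * (eps * max_gap M theta) / 4.
  by rewrite /K; field.
lra.
Qed.
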